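(* Let $I=\mathbb{R}$ or $I=[0,\infty)$, let $F:(0,\infty)\times I\to(0,\infty)$, and let $f:I\to X$ be such that $\|f(\cdot+\tau)-f(\cdot)\|\in L^1(K)$ for every $\tau\in I$ and every compact $K\subseteq I$. Suppose that $\phi:[0,\infty)\to[0,\infty)$ is convex and that there exists a function $\varphi:[0,\infty)\to[0,\infty)$ such that $\phi(lx)\le\varphi(l)\phi(x)$ for all $l>0$ and $x\ge0$. Set $F_1(l,t):=F(l,t)\,l\,[\varphi(l)]^{-1}$ and $F_2(l,t):=l^{-1}\varphi(F(l,t)l)$ for $l>0$, $t\in I$ (it being understood that these are functions $(0,\infty)\times I\to(0,\infty)$ in the part where they are used). Then: (i) if $f$ is equi-Weyl-$(1,\phi,F)$-almost periodic [respectively, Weyl-$(1,\phi,F)$-almost periodic], then $f$ is equi-Weyl-$(1,\phi,F_1)_1$-almost periodic [respectively, Weyl-$(1,\phi,F_1)_1$-almost periodic]; (ii) if $f$ is equi-Weyl-$(1,\phi,F_2)$-almost periodic [respectively, Weyl-$(1,\phi,F_2)$-almost periodic], then $f$ is equi-Weyl-$(1,\phi,F)_2$-almost periodic [respectively, Weyl-$(1,\phi,F)_2$-almost periodic].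
   Context: $X$ is a complex Banach space. Below, $p\equiv 1$, $F:(0,\infty)\times I\to(0,\infty)$, and for $\tau\in I$ write $\Delta_\tau f(s):=\|f(s+\tau)-f(s)\|$. For each of the three functionals $$N(l,\tau)=\sup_{t\in I}F(l,t)\,\|\phi(\Delta_\tau f)\|_{L^1[t,t+l]},\qquad N_1(l,\tau)=\sup_{t\in I}F(l,t)\,\phi\bigl(\|\Delta_\tau f\|_{L^1[t,t+l]}\bigr),\qquad N_2(l,\tau)=\sup_{t\in I}\phi\bigl(F(l,t)\,\|\Delta_\tau f\|_{L^1[t,t+l]}\bigr),$$ $f$ is called equi-Weyl-$(1,\phi,F)$-almost periodic (using $N$), equi-Weyl-$(1,\phi,F)_1$-almost periodic (using $N_1$), equi-Weyl-$(1,\phi,F)_2$-almost periodic (using $N_2$) iff for each $\epsilon>0$ there are $l>0$ and $L>0$ such that every interval $I'\subseteq I$ of length $L$ contains a point $\tau\in I'$ at which the corresponding functional at $(l,\tau)$ is $\le\epsilon$. It is called Weyl-$(1,\phi,F)$-, Weyl-$(1,\phi,F)_1$-, Weyl-$(1,\phi,F)_2$-almost periodic iff for each $\epsilon>0$ there is $L>0$ such that every interval $I'\subseteq I$ of length $L$ contains a point $\tau\in I'$ for which the $\limsup_{l\to\infty}$ of the corresponding functional at $(l,\tau)$ is $\le\epsilon$. The definitions of the $(1,\phi,F)$-classes require $\phi(\Delta_\tau f)\in L^1(K)$, and those of the $(1,\phi,F)_i$-classes ($i=1,2$) require $\Delta_\tau f\in L^1(K)$, for all $\tau\in I$ and all compact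 $K\subseteq I$. *)

(* Defs.v *)
From HB Require Import structures.
From mathcomp Require Import all_boot all_order all_algebra.
From mathcomp Require Import complex.
From mathcomp Require Import all_classical all_reals all_analysis.

Set Implicit Arguments.
Unset Strict Implicit.
Unset Printing Implicit Defensive.

Import Order.TTheory GRing.Theory Num.Theory.
Import numFieldNormedType.Exports.

Local Open Scope classical_set_scope.
Local Open Scope ring_scope.

(* A function on I (resp. on (0, +oo) x I, [0, +oo)) is represented by a total
   function that is only ever evaluated, integrated or constrained there.
   Measurability and integrals are with respect to the completed Lebesgue
   measure, i.e. Lebesgue rather than Borel measurability. *)

Section weyl_almost_periodic.
Context {R : realType}.

Definition half_line_or_line (I : set R) : Prop :=
  I = setT \/ I = [set t | 0 <= t].

Definition positive_weight (I : set R) (F : R -> R -> R) : Prop :=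
  forall l t : R, 0 < l -> I t -> 0 < F l t.

Definition L1_on_compacts (I : set R) (g : R -> R) : Prop :=
  forall K : set R, compact K -> K `<=` I ->
    (@completed_lebesgue_measure R).-integrable K (EFin \o g).

Definition L1norm (a b : R) (g : R -> R) : R :=
  \int[@completed_lebesgue_measure R]_(s in `[a, b]) `|g s|.

(* N l tau is the value of the functional at (l, tau), possibly +oo *)
Definition equi_weyl_cond (I : set R) (N : R -> R -> \bar R) : Prop :=
  forall eps : R, 0 < eps -> exists l L : R, [/\ 0 < l, 0 < L &
    forall J : set R, is_interval J -> J `<=` I -> lebesgue_measure J = L%:E ->
      exists2 tau, J tau & (N l tau <= eps%:E)%E].

Definition weyl_cond (I : set R) (N : R -> R -> \bar R) : Prop :=
  forall eps : R, 0 < eps -> exists2 L : R, 0 < L &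
    forall J : set R, is_interval J -> J `<=` I -> lebesgue_measure J = L%:E ->
      exists2 tau, J tau &
        (limf_esup (fun l => N l tau) (pinfty_nbhs R) <= eps%:E)%E.

Section functionals.
Variables (X : completeNormedModType R[i]) (I : set R).
Variables (phi : R -> R) (F : R -> R -> R) (f : R -> X).

(* the norm of X takes its (real, nonnegative) values in R[i] *)
Definition Delta (tau s : R) : R := complex.Re `|f (s + tau) - f s|.

Definition weylN (l tau : R) : \bar R :=
  ereal_sup [set (F l t * L1norm t (t + l) (phi \o Delta tau))%:E | t in I].

Definition weylN1 (l tau : R) : \bar R :=
  ereal_sup [set (F l t * phi (L1norm t (t + l) (Delta tau)))%:E | t in I].

Definition weylN2 (l tau : R) : \bar R :=
  ereal_sup [set (phi (F l t * L1norm t (t + l) (Delta tau)))%:E | t in I].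

Definition Delta_L1 : Prop :=
  forall tau, I tau -> L1_on_compacts I (Delta tau).

Definition phi_Delta_L1 : Prop :=
  forall tau, I tau -> L1_on_compacts I (phi \o Delta tau).

Definition equi_weyl_ap : Prop := phi_Delta_L1 /\ equi_weyl_cond I weylN.
Definition equi_weyl_ap1 : Prop := Delta_L1 /\ equi_weyl_cond I weylN1.
Definition equi_weyl_ap2 : Prop := Delta_L1 /\ equi_weyl_cond I weylN2.

Definition weyl_ap : Prop := phi_Delta_L1 /\ weyl_cond I weylN.
Definition weyl_ap1 : Prop := Delta_L1 /\ weyl_cond I weylN1.
Definition weyl_ap2 : Prop := Delta_L1 /\ weyl_cond I weylN2.

End functionals.
End weyl_almost_periodic.

(* Main.v *)
Require Import Defs.
From HB Require Import structures.
From mathcomp Require Import all_boot all_order all_algebra.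
From mathcomp Require Import complex.
From mathcomp Require Import all_classical all_reals all_analysis.
From mathcomp Require Import measurable_realfun ring lra.

Import Order.TTheory GRing.Theory Num.Theory.
Import numFieldNormedType.Exports.

Local Open Scope classical_set_scope.
Local Open Scope ring_scope.

(** Everything reduces to one pointwise inequality. Let [A] and [B] be the
    [L^1] norms of [g = Delta_tau f] and of [phi o g] on [[t, t + l]]. The
    measure [ds / l] is a probability on that interval, so Jensen's inequality
    gives [phi (A / l) <= B / l]; writing [r A = (r l) (A / l)] and using
    [phi (a x) <= varphi a * phi x] with [a = r l],
<<
      phi (r A) <= varphi (r l) * phi (A / l) <= l^-1 * varphi (r l) * B.
>>
    This is [phi_L1norm_le]. For [r = 1], multiplying by [F1 l t] cancels
    [l^-1 * varphi l] and leaves [F l t * B], which is part (i); for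
    [r = F l t] the factor in front of [B] is [F2 l t], which is part (ii).
    So at each [(l, tau)] with [l > 0] the new functional is at most the old
    one, and the same [l], [L] and [tau] witness the new almost periodicity
    ([equi_weyl_cond_le], [weyl_cond_le]).

    Jensen's inequality ([jensen_nonneg]) is obtained by integrating the
    supporting affine function of [phi] at the mean of [g]
    ([convex_function_support]). Such a function exists only at interior points
    of [[0, +oo)]: at [0] a convex function may have slope [-oo] or jump. A
    nonnegative function of mean [0] vanishes almost everywhere, though, and
    then Jensen's inequality is an equality. *)

(** The denominators of the chord inequality are cleared, so that it can be read
    as a comparison of the slopes on either side of [m]. *)
Lemma convex_function_chord (R : realType) (D : set R^o) (phi : R^o -> R^o)
    (x m y : R) : convex_function D phi -> D x -> D y -> x < m -> m < y ->
  (y - x) * phi m <= (y - m) * phi x + (m - x) * phi y.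
Proof.
move=> cphi Dx Dy xm my.
have yx0 : 0 < y - x by lra.
have t01 : 0 <= (y - m) / (y - x) <= 1.
  by rewrite divr_ge0 ?ler_pdivrMr//=; lra.
have := cphi (Itv01 (andP t01).1 (andP t01).2) x y.
rewrite !inE => /(_ Dx Dy).
rewrite !convR_line_path /line_path /=.
rewrite [X in phi X <= _](_ : _ = m); last first.
  change ((y - m) / (y - x) * x + (1 - (y - m) / (y - x)) * y = m :> R).
  by field; apply: lt0r_neq0.
rewrite -(ler_pM2l yx0) => /le_trans; apply; rewrite le_eqVlt; apply/orP; left.
by apply/eqP; field; apply: lt0r_neq0.
Qed.

(** The slopes of the chords ending at [m] from the left are bounded above by
    every slope of a chord starting at [m], by the chord inequality. Their
    supremum is thus squeezed between the left and the right slopes, and serves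
    as the slope of a supporting line. The points [a] and [b] make [m] interior:
    [a] makes the set of left slopes nonempty and [b] makes it bounded. *)
Lemma convex_function_support (R : realType) (D : set R^o) (phi : R^o -> R^o)
    (a m b : R) : convex_function D phi -> D a -> D b -> a < m -> m < b ->
  exists c : R, forall x : R, D x -> phi m + c * (x - m) <= phi x.
Proof.
move=> cphi Da Db am mb.
pose slope (x : R) : R := (phi x - phi m) / (x - m).
pose S := [set slope x | x in [set x : R | D x /\ x < m]].
have slopeS y : D y -> m < y -> ubound S (slope y).
  move=> Dy my _ [x [Dx xm] <-].
  have := convex_function_chord _ _ _ _ _ _ cphi Dx Dy xm my => chord.
  have xm0 : 0 < m - x by lra.
  have my0 : 0 < y - m by lra.
  rewrite /slope -(opprB m x) invrN mulrN -mulNr opprB.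
  by rewrite ler_pdivrMr// mulrAC ler_pdivlMr//; lra.
have S0 : S !=set0 by exists (slope a); exists a.
have ubS : has_ubound S by exists (slope b); exact: slopeS.
exists (sup S) => x Dx; have [xm|mx|->] := ltgtP x m.
- have : slope x <= sup S by apply: ub_le_sup => //; exists x.
  rewrite /slope ler_ndivrMr ?subr_lt0// => H; lra.
- have : sup S <= slope x by apply: ge_sup => //; exact: slopeS.
  by rewrite /slope ler_pdivlMr ?subr_gt0// => H; lra.
- by rewrite subrr mulr0 addr0.
Qed.

(** Jensen's inequality on a set of measure [l], scaled by [l]. Integrability of
    [phi o g] is a hypothesis because a convex function need not be Lipschitz
    near infinity, so it does not follow from that of [g]. *)
Lemma jensen_nonneg d (T : measurableType d) (R : realType)
    (mu : {measure set T -> \bar R}) (D : set T) (l : R) (g : T -> R)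
    (phi : R -> R) :
  measurable D -> mu D = l%:E -> 0 < l ->
  mu.-integrable D (EFin \o g) -> mu.-integrable D (EFin \o (phi \o g)) ->
  (forall s, D s -> 0 <= g s) ->
  convex_function [set x : R^o | 0 <= x] (phi : R^o -> R^o) ->
  l * phi (l^-1 * \int[mu]_(s in D) g s) <= \int[mu]_(s in D) phi (g s).
Proof.
move=> mD muD l0 ig ipg g0 cphi.
set m := l^-1 * _.
have intg : \int[mu]_(s in D) g s = l * m by rewrite /m mulVKf// gt_eqF.
have icst (r : R) : mu.-integrable D (EFin \o cst r).
  apply/integrableP; split; first exact/measurable_EFinP.
  by rewrite [ltLHS](integral_cst mu mD `|r|%:E) muD -EFinM ltry.
have intcst (r : R) : \int[mu]_(_ in D) r = l * r.
  by rewrite Rintegral_cst// muD mulrC.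
have m0 : 0 <= m by rewrite mulr_ge0 ?invr_ge0 ?(ltW l0)// Rintegral_ge0.
(* [phi] may have no supporting line at 0, so a zero mean is treated apart:
   then [g = 0] and [phi o g = phi 0] almost everywhere. *)
move: m0; rewrite le_eqVlt => /predU1P[m0|m0].
  rewrite -m0 mulr0 in intg; rewrite -m0.
  have mg := measurable_int _ ig.
  have gae : ae_eq mu D (EFin \o g) (cst 0%E).
    apply/(ae_eq_integral_abs _ mD mg).
    transitivity (\int[mu]_(s in D) (g s)%:E)%E.
      by apply: eq_integral => s /set_mem Ds /=; rewrite ger0_norm// g0.
    by rewrite -[LHS]fineK ?integrable_fin_num//= -[fine _]/(Rintegral _ _ _) intg.
  rewrite -intcst le_eqVlt; apply/orP; left; apply/eqP.
  congr fine; apply: ae_eq_integral => //.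
  - exact: (measurable_int _ ipg).
  - by apply: filterS gae => s /= gs Ds; have [->] := gs Ds.
(* Any point beyond [m] serves on the right; [m + 1] is one. *)
have [|||c supp] := convex_function_support _ _ _ 0 m (m + 1) cphi _ _ m0.
- exact: lexx.
- by rewrite /= addr_ge0// ltW.
- by lra.
have ilin : mu.-integrable D (EFin \o (fun s => c * g s)).
  exact: (integrableZl mD c ig).
have iaff : mu.-integrable D (EFin \o (fun s => (phi m - c * m) + c * g s)).
  exact: (integrableD mD (icst _) ilin).
have <- : \int[mu]_(s in D) ((phi m - c * m) + c * g s) = l * phi m.
  rewrite RintegralD//; last exact: icst.
  by rewrite (RintegralZl c mD ig) intcst intg; ring.
by apply: le_Rintegral => // s Ds /=; have := supp _ (g0 _ Ds); lra.
Qed.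

(** The completed measure and the Lebesgue measure are the same outer measure,
    on two sigma-algebras, so lengths of intervals carry over by conversion. *)
Lemma completed_lebesgue_measure_itvcc (R : realType) (a b : R) : a < b ->
  completed_lebesgue_measure [set` `[a, b]] = (b - a)%:E.
Proof.
move=> ab.
rewrite -[LHS]/(lebesgue_measure [set` `[a, b]]) lebesgue_measure_itv/=.
by rewrite lte_fin ab EFinN -EFinD.
Qed.

Lemma caratheodory_measurable_itvcc (R : realType) (a b : R) :
  measurable ([set` `[a, b]] :
    set (caratheodory_type (R := R) (wlength idfun)^*%mu)).
Proof. by apply: sub_caratheodory; exact: measurable_itv. Qed.

Lemma equi_weyl_cond_le (R : realType) (I : set R) (N N' : R -> R -> \bar R) :
  (forall l tau, 0 < l -> I tau -> (N' l tau <= N l tau)%E) ->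
  equi_weyl_cond I N -> equi_weyl_cond I N'.
Proof.
move=> NN' cN e /cN [l [L [l0 L0 H]]]; exists l, L; split=> // J iJ JI mJ.
have [tau Jtau Ne] := H J iJ JI mJ; exists tau => //.
by apply: le_trans Ne; apply: NN' => //; exact: JI.
Qed.

(** Each set of the filter is first shrunk to the points where the comparison
    holds, which can only lower the supremum. Domination along the filter is all
    that is asked, as the functionals are compared for [l > 0] alone. *)
Lemma limf_esup_le (T : choiceType) (X : filteredType T) (R : realType)
    (Fl : set_system X) (f g : X -> \bar R) : Filter Fl ->
  (\forall x \near Fl, (f x <= g x)%E) -> (limf_esup f Fl <= limf_esup g Fl)%E.
Proof.
move=> FF fg; apply: le_ereal_inf_tmp => _ [V FV <-].
apply: ge_ereal_inf; exists (ereal_sup (f @` (V `&` [set x | (f x <= g x)%E]))).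
  by exists (V `&` [set x | (f x <= g x)%E]) => //; exact: filterI.
apply: ge_ereal_sup => _ [x [Vx fgx] <-].
by apply: le_ereal_sup_tmp; exists (g x) => //; exists x.
Qed.

Lemma weyl_cond_le (R : realType) (I : set R) (N N' : R -> R -> \bar R) :
  (forall l tau, 0 < l -> I tau -> (N' l tau <= N l tau)%E) ->
  weyl_cond I N -> weyl_cond I N'.
Proof.
move=> NN' cN e /cN [L L0 H]; exists L => // J iJ JI mJ.
have [tau Jtau Ne] := H J iJ JI mJ; exists tau => //.
apply: le_trans Ne; apply: limf_esup_le.
by exists 0; split => // l l0; apply: NN' => //; exact: JI.
Qed.

Lemma ereal_sup_image_le (T : Type) (R : realType) (A : set T) (f g : T -> \bar R) :
  (forall x, A x -> (f x <= g x)%E) ->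
  (ereal_sup [set f x | x in A] <= ereal_sup [set g x | x in A])%E.
Proof.
move=> fg; apply: ge_ereal_sup => _ [x Ax <-].
by apply: le_ereal_sup_tmp; exists (g x); [exists x | exact: fg].
Qed.

Lemma half_line_or_line_itvcc (R : realType) (I : set R) (t l : R) :
  half_line_or_line I -> I t -> [set` `[t, t + l]] `<=` I.
Proof.
move=> [->|->] //= t0 s /=; rewrite in_itv/= => /andP[ts _].
exact: le_trans ts.
Qed.

Lemma Delta_ge0 (R : realType) (X : completeNormedModType R[i]) (f : R -> X)
    (tau s : R) : 0 <= Delta f tau s.
Proof. by have := normr_ge0 (f (s + tau) - f s); rewrite lecE => /andP[]. Qed.

(** The scaling [r] is what lets (i) and (ii) share one estimate. The growth
    condition is applied to the factor [r * l] rather than [r], because Jensen's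
    inequality controls [phi] at the mean of [g] and not at its integral. *)
Lemma phi_L1norm_le (R : realType) (phi varphi : R -> R) (g : R -> R)
    (t l r : R) :
  convex_function [set x : R^o | 0 <= x] (phi : R^o -> R^o) ->
  (forall x, 0 <= x -> 0 <= phi x) ->
  (forall x, 0 <= x -> 0 <= varphi x) ->
  (forall a x : R, 0 < a -> 0 <= x -> phi (a * x) <= varphi a * phi x) ->
  (forall s, 0 <= g s) ->
  (@completed_lebesgue_measure R).-integrable `[t, t + l] (EFin \o g) ->
  (@completed_lebesgue_measure R).-integrable `[t, t + l]
    (EFin \o (phi \o g)) ->
  0 < l -> 0 < r ->
  phi (r * L1norm t (t + l) g) <=
    l^-1 * varphi (r * l) * L1norm t (t + l) (phi \o g).
Proof.
move=> cphi phi0 vphi0 sub g0 ig ipg l0 r0.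
have Eg : L1norm t (t + l) g =
    \int[@completed_lebesgue_measure R]_(s in `[t, t + l]) g s.
  by apply: eq_Rintegral => s _; rewrite ger0_norm.
have Epg : L1norm t (t + l) (phi \o g) =
    \int[@completed_lebesgue_measure R]_(s in `[t, t + l]) phi (g s).
  by apply: eq_Rintegral => s _; rewrite ger0_norm ?phi0.
have jensen : l * phi (l^-1 * L1norm t (t + l) g) <= L1norm t (t + l) (phi \o g).
  rewrite Eg Epg; apply: jensen_nonneg => //.
  - exact: caratheodory_measurable_itvcc.
  - rewrite [LHS](completed_lebesgue_measure_itvcc _ t (t + l)) ?ltrDl//.
    by rewrite addrAC subrr add0r.
have A0 : 0 <= L1norm t (t + l) g by apply: Rintegral_ge0.
have -> : r * L1norm t (t + l) g = (r * l) * (l^-1 * L1norm t (t + l) g).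
  by rewrite mulrA mulfK// gt_eqF.
apply: le_trans (sub _ _ _ _) _; rewrite ?mulr_gt0//.
  by rewrite mulr_ge0// invr_ge0 ltW.
rewrite [l^-1 * varphi _]mulrC -mulrA ler_wpM2l//.
  by rewrite vphi0// ltW// mulr_gt0.
by rewrite -(ler_pM2l l0) mulVKf// gt_eqF.
Qed.

Theorem proposition2p5 (R : realType) (X : completeNormedModType R[i])
    (I : set R) (hI : half_line_or_line I)
    (F : R -> R -> R) (hF : positive_weight I F)
    (f : R -> X) (hf : Delta_L1 I f)
    (phi : R -> R) (hphi : forall x : R, 0 <= x -> 0 <= phi x)
    (hconv : convex_function [set x : R^o | 0 <= x] (phi : R^o -> R^o))
    (varphi : R -> R) (hvarphi : forall l : R, 0 <= l -> 0 <= varphi l)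
    (hmul : forall l x : R, 0 < l -> 0 <= x -> phi (l * x) <= varphi l * phi x) :
  let F1 := fun l t : R => F l t * l * (varphi l)^-1 in
  let F2 := fun l t : R => l^-1 * varphi (F l t * l) in
  (positive_weight I F1 ->
     (equi_weyl_ap I phi F f -> equi_weyl_ap1 I phi F1 f) /\
     (weyl_ap I phi F f -> weyl_ap1 I phi F1 f)) /\
  (positive_weight I F2 ->
     (equi_weyl_ap I phi F2 f -> equi_weyl_ap2 I phi F f) /\
     (weyl_ap I phi F2 f -> weyl_ap2 I phi F f)).
Proof.
move=> F1 F2.
have key : phi_Delta_L1 I phi f -> forall l tau t r : R, 0 < l -> I tau -> I t ->
    0 < r -> phi (r * L1norm t (t + l) (Delta f tau)) <=
      l^-1 * varphi (r * l) * L1norm t (t + l) (phi \o Delta f tau).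
  move=> hpf l tau t r l0 Itau It r0.
  have KI := half_line_or_line_itvcc _ _ _ l hI It.
  apply: phi_L1norm_le => //; first exact: Delta_ge0.
    by apply: hf => //; exact: segment_compact.
  by apply: hpf => //; exact: segment_compact.
split=> [hF1|_].
  have N1_le : phi_Delta_L1 I phi f -> forall l tau, 0 < l -> I tau ->
      (weylN1 I phi F1 f l tau <= weylN I phi F f l tau)%E.
    move=> hpf l tau l0 Itau; apply: ereal_sup_image_le => t It; rewrite lee_fin.
    (* Since 0 is its own inverse here, [F1 l t] would vanish with [varphi l]. *)
    have v0 : varphi l != 0.
      by apply: contraTneq (hF1 _ _ l0 It) => v0; rewrite /F1 v0 invr0 mulr0 ltxx.
    have := key hpf l tau t 1 l0 Itau It ltr01; rewrite !mul1r.
    move=> /(ler_wpM2l (ltW (hF1 _ _ l0 It))) /le_trans; apply.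
    rewrite le_eqVlt; apply/orP; left; apply/eqP; rewrite /F1; field.
    by rewrite v0 gt_eqF.
  split=> -[hpf cN]; split=> //.
    exact: equi_weyl_cond_le _ _ _ _ (N1_le hpf) cN.
  exact: weyl_cond_le _ _ _ _ (N1_le hpf) cN.
have N2_le : phi_Delta_L1 I phi f -> forall l tau, 0 < l -> I tau ->
    (weylN2 I phi F f l tau <= weylN I phi F2 f l tau)%E.
  move=> hpf l tau l0 Itau; apply: ereal_sup_image_le => t It; rewrite lee_fin.
  by apply: key => //; exact: hF.
split=> -[hpf cN]; split=> //.
  exact: equi_weyl_cond_le _ _ _ _ (N2_le hpf) cN.
exact: weyl_cond_le _ _ _ _ (N2_le hpf) cN.
Qed.
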